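(* Let $\vartheta^*\in(0,1)$ and $k_n^*=\lfloor n\vartheta^*\rfloor$. Consider the functional linear model $Y_i=\alpha+\langle X_i,\beta\rangle+\varepsilon_i$, $i=1,\dots,n$, with estimators $\hat\alpha,\hat\beta$ and test statistic $T_n$ as described in the context. Assume: (i) $|\hat\alpha-\alpha|=o_{\mathbb{P}}(1)$ and $\|\hat\beta-\beta\|=o_{\mathbb{P}}(1)$ as $n\to\infty$; (ii) $\varepsilon_1,\dots,\varepsilon_{k_n^*}$ are iid with cumulative distribution function $F_1$, and $\varepsilon_{k_n^*+1},\dots,\varepsilon_n$ are iid with cumulative distribution function $F_2\ne F_1$, where $F_1$ and $F_2$ are Hölder-continuous of order $\gamma_1,\gamma_2\in(0,1]$ with Hölder constants $c_1,c_2$, respectively; (iii) with $P_1$ the distribution of $(X_1,\varepsilon_1)$ (before the change) and $P_2$ the distribution of $(X_n,\varepsilon_n)$ (after the change), for both $P=P_1$ and $P=P_2$ it holds that $\mathbb{P}(\hat\beta-\beta\in\mathcal{B})\to1$ as $n\to\infty$ for a class $\mathcal{B}\subset\mathcal{H}$ such that the function class $$\mathcal{F}=\left\{(x,e)\mapsto I\{e\le v+\langle x,b\rangle\}\mid v\in\mathbb{R},\,b\in\mathcal{B}\right\}$$ is $P$-Donsker. Then, for every fixed $q>0$, the test that rejects the null hypothesis of no change point if $T_n>q$ is consistent, i.e. $\mathbb{P}(T_n>q)\to1$ as $n\to\infty$.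
   Context: Setting. $\mathcal{H}$ is a separable Hilbert space with inner product $\langle\cdot,\cdot\rangle$, norm $\|\cdot\|$ and Borel sigma-field. $(X_i,Y_i)$, $i=1,\dots,n$, are independent $(\mathcal{H}\times\mathbb{R})$-valued random variables on a common probability space with probability measure $\mathbb{P}$, satisfying $Y_i=\alpha+\langle X_i,\beta\rangle+\varepsilon_i$ with parameters $\alpha\in\mathbb{R}$, $\beta\in\mathcal{H}$. The covariates $X_1,\dots,X_n$ are iid with $E\|X_i\|<\infty$; the errors $\varepsilon_1,\dots,\varepsilon_n$ are independent, centered, and independent of the covariates (the errors and data may depend on $n$, which is suppressed in the notation; $\vartheta^*,F_1,F_2,\alpha,\beta$ are fixed). $\hat\alpha$ and $\hat\beta$ are estimators, based on the whole sample $(X_i,Y_i)$, $i=1,\dots,n$, of $\alpha$ and $\beta$, with values in $\mathbb{R}$ and $\mathcal{H}$. Residuals: $\hat\varepsilon_i=Y_i-\hat\alpha-\langle X_i,\hat\beta\rangle$. Test statistic. $T_n=\sup_{t\in[0,1]}\sup_{z\in\mathbb{R}}|\hat G_n(t,z)|$, where $$\hat G_n(t,z)=\frac{\lfloor nt\rfloor(n-\lfloor nt\rfloor)}{n^{3/2}}\left(\hat F_{\lfloor nt\rfloor}(z)-\tilde F_{\lfloor nt\rfloor}(z)\right),$$ $$\hat F_k(z)=\frac1k\sum_{i=1}^k I\{\hat\varepsilon_i\le z\},\qquad \tilde F_k(z)=\frac1{n-k}\sum_{i=k+1}^n I\{\hat\varepsilon_i\le z\},$$ and $\hat G_n(t,z)=0$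 when $\lfloor nt\rfloor\in\{0,n\}$. *)

(* Defs.v *)
From HB Require Import structures.
From mathcomp Require Export all_boot all_order all_algebra.
From mathcomp Require Export all_classical all_reals all_analysis.

Set Implicit Arguments.
Unset Strict Implicit.
Unset Printing Implicit Defensive.

Import Order.TTheory GRing.Theory Num.Theory.
Import numFieldNormedType.Exports.

Local Open Scope classical_set_scope.
Local Open Scope ring_scope.

Notation borel T := (g_sigma_algebraType (@open T)).

Definition separable (T : topologicalType) : Prop :=
  exists D : set T, countable D /\ dense D.

Definition hoelder_continuous (R : realType) (f : R -> R) (gamma c : R) :
    Prop :=
  forall x y, `|f x - f y| <= c * `|x - y| `^ gamma.

Section probability_notions.
Context d (T : measurableType d) (R : realType) (P : probability T R).

(* Only full products are required: the product rule for a subfamily is the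
   case where the remaining A i are setT. *)
Definition mutually_independent d' (S : measurableType d') (I : finType)
    (Z : I -> T -> S) : Prop :=
  forall A : I -> set S, (forall i, measurable (A i)) ->
    P [set w | forall i, A i (Z i w)] = (\prod_(i : I) P (Z i @^-1` A i))%E.

Definition independent d1 d2 (S1 : measurableType d1) (S2 : measurableType d2)
    (U : T -> S1) (V : T -> S2) : Prop :=
  forall A B, measurable A -> measurable B ->
    P (U @^-1` A `&` V @^-1` B) = (P (U @^-1` A) * P (V @^-1` B))%E.

Definition has_law d' (S : measurableType d') (Z : T -> S)
    (Q : probability S R) : Prop :=
  forall A, measurable A -> pushforward P Z A = Q A.

Definition identically_distributed d' (S : measurableType d') (I : Type)
    (Z : I -> T -> S) : Prop :=
  forall i j A, measurable A -> pushforward P (Z i) A = pushforward P (Z j) A.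

Definition cvg_in_probability0 (Z : nat -> T -> R) : Prop :=
  forall e, 0 < e -> P [set w | e < `|Z n w|] @[n --> \oo] --> 0%E.

(* E^* h, for bounded h. Dominating functions of infinite integral would not
   change the infimum and are left out. *)
Definition outer_expectation (h : T -> R) : \bar R :=
  ereal_inf [set (\int[P]_w (u w)%:E)%E | u in
    [set u : T -> R | P.-integrable setT (EFin \o u) /\
                      (forall w, h w <= u w)]].

(* P^* A, which is P A for every measurable A. *)
Definition outer_probability (A : set T) : \bar R := mu_ext P A.

End probability_notions.

Section iid_law.
Context d (S : measurableType d) (R : realType) (P : probability S R).

Definition cons_pair n (p : S * n.-tuple S) : n.+1.-tuple S :=
  [the n.+1.-tuple S of p.1 :: p.2].

Lemma measurable_cons_pair n : measurable_fun setT (@cons_pair n).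
Proof. by apply: measurable_cons; [exact: measurable_fst|exact: measurable_snd]. Qed.

HB.instance Definition _ n := isMeasurableFun.Build _ _ _ _ (@cons_pair n)
  (@measurable_cons_pair n).

(* The product measure P^n on n.-tuple S. *)
Fixpoint iid_law n : probability (n.-tuple S) R :=
  match n with
  | 0 => dirac [tuple]
  | m.+1 => distribution (P \x iid_law m)%E (@cons_pair m)
  end.

End iid_law.

Section linfty.
Variables (I : choiceType) (R : realType).

(* l^oo(I): the bounded functions on I with the topology of uniform
   convergence, i.e. that of the sup norm. *)
Definition linfty_set : set {uniform I -> R} :=
  [set z : I -> R | exists M : R, forall i, `|z i| <= M].

Definition linfty : Type := set_type linfty_set.

HB.instance Definition _ := Topological.copy linfty (set_type linfty_set).

Definition linfty_fun (z : linfty) : I -> R := set_val z.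

Lemma linfty_set0 : linfty_set (fun=> 0).
Proof. by exists 0 => i; rewrite normr0. Qed.

HB.instance Definition _ :=
  isPointed.Build linfty (SigSub (mem_set linfty_set0)).

End linfty.

Definition tight (T : ptopologicalType) (R : realType)
    (L : probability (borel T) R) : Prop :=
  forall e : R, 0 < e ->
    exists2 K : set T, compact K & ((1 - e)%:E <= L K)%E.

Section donsker.
Context d (S : measurableType d) (R : realType).

Definition empirical_process (P : probability S R) n (x : n.-tuple S)
    (f : S -> R) : R :=
  Num.sqrt n%:R *
  (n%:R^-1 * (\sum_(i < n) f (tnth x i)) - \int[P]_y f y).

(* Donsker classes in the sense of Hoffmann-Jorgensen weak convergence: for an
   iid sample from P (the coordinates of P^n), the empirical process is a map
   into l^oo(F) and converges weakly there to a tight Borel law L, that is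
   E^* h(G_n) --> \int h dL for every bounded continuous h on l^oo(F). *)
Definition donsker (P : probability S R) (F : set (S -> R)) : Prop :=
  (forall f, F f -> P.-integrable setT (EFin \o f)) /\
  exists G : forall n, n.-tuple S -> linfty F R,
    (forall n x (f : F),
       linfty_fun (G n x) f = empirical_process P x (set_val f)) /\
    exists L : probability (borel (linfty F R)) R,
      tight L /\
      forall h : linfty F R -> R,
        continuous h -> (exists M : R, forall z, `|h z| <= M) ->
        outer_expectation (iid_law P n) (h \o G n) @[n --> \oo] -->
          (\int[L]_z (h z)%:E)%E.

End donsker.

Section change_point_test.
Variable R : realType.

Definition Fhat n (e : 'I_n -> R) (k : nat) (z : R) : R :=
  k%:R^-1 * \sum_(i < n | (i < k)%N) (e i <= z)%R%:R.

Definition Ftilde n (e : 'I_n -> R) (k : nat) (z : R) : R :=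
  (n - k)%:R^-1 * \sum_(i < n | (k <= i)%N) (e i <= z)%R%:R.

(* Since 0^-1 = 0 and the leading factor vanishes, this is 0 when
   the truncation of n * t is 0 or n. *)
Definition Ghat n (e : 'I_n -> R) (t z : R) : R :=
  let k := Num.truncn (n%:R * t) in
  (k * (n - k))%:R / n%:R `^ (3 / 2) * (Fhat e k z - Ftilde e k z).

Definition Tstat n (e : 'I_n -> R) : R :=
  sup [set sup [set `|Ghat e t z| | z in [set: R]] | t in `[0, 1]].

Definition change_point (theta : R) (n : nat) : nat :=
  Num.truncn (n%:R * theta).

End change_point_test.

Section functional_linear_model.
Variables (R : realType) (H : completeNormedModType R).
Variable ip : H -> H -> R.

(* (X_1, Y_1), ..., (X_n, Y_n) *)
Definition sample T n (X : 'I_n -> T -> borel H) (Y : 'I_n -> T -> R) (w : T) :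
    n.-tuple (borel H * R)%type :=
  [tuple (X i w, Y i w) | i < n].

Definition residual T n (X : 'I_n -> T -> borel H) (Y : 'I_n -> T -> R)
    (ahat : n.-tuple (borel H * R)%type -> R)
    (bhat : n.-tuple (borel H * R)%type -> borel H) (w : T) (i : 'I_n) : R :=
  Y i w - ahat (sample X Y w) - ip (X i w) (bhat (sample X Y w)).

Definition halfspace_class (B : set H) : set (borel H * R -> R) :=
  [set f | exists v : R, exists2 b : H, B b &
    f = fun p : borel H * R => (p.2 <= v + ip p.1 b)%R%:R].

End functional_linear_model.

(* Main.v *)
Require Import Defs.
From mathcomp Require Import all_boot all_order all_algebra.
From mathcomp Require Import all_classical all_reals all_analysis.
From mathcomp Require Import measurable_realfun ring lra.

Set Implicit Arguments.
Unset Strict Implicit.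
Unset Printing Implicit Defensive.

Import Order.TTheory GRing.Theory Num.Theory.
Import numFieldNormedType.Exports.

Local Open Scope classical_set_scope.
Local Open Scope ring_scope.

(** At a point z where F1 and F2 differ, the empirical distribution functions of
the residuals before and after the change converge in probability to F1 z and to
F2 z. On an event whose probability tends to 1 their difference is therefore at
least half of |F1 z - F2 z|, and at t = theta the weight in front of it,
k (n - k) / n^(3/2), grows like sqrt n ([weight_ge]); hence T_n, which dominates
|G_n(theta, z)|, exceeds every fixed q ([Tstat_large]).

The convergence at the single point z is [freq_perturbed_cvg]. By Cauchy-Schwarz
a residual differs from its error by at most
|ahat - alpha| + |X_i| |bhat - beta|. When both estimation errors are small, this
is at most a fixed small number delta for all i with |X_i| <= M. The fraction of
residuals below z thus lies between the fractions of errors below z - delta and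
below z + delta, up to the fraction of i with |X_i| > M. Each of these three
frequencies obeys the weak law of large numbers ([weak_law_preimage]), the limits
at z - delta and z + delta are close to F z by Hoelder continuity, and the third
limit is small for large M because the law of X_i is tight.

Since a measure is only controlled on measurable sets, the event T_n > q has to
be shown measurable as well. This takes two reductions: T_n is a supremum of
finitely many step functions ([measurable_lt_Tstat]), and the inner product of
two random elements is measurable because H is separable
([measurable_inner_product]). *)

(** * Measurability in a separable Hilbert space *)

Lemma measurable_pred (d : measure_display) (T : measurableType d)
    (b : T -> bool) :
  measurable_fun [set: T] b -> measurable [set w | b w].
Proof. by move=> mb; rewrite -[X in measurable X]setTI; exact: mb. Qed.

Lemma measurable_ltr_set (d : measure_display) (T : measurableType d)
    (R : realType) (c : R) (f : T -> R) :
  measurable_fun [set: T] f -> measurable [set w | c < f w].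
Proof.
by move=> mf; apply: measurable_pred; apply: measurable_fun_ltr.
Qed.

Lemma countable_bigcup_measurable (d : measure_display) (T : measurableType d)
    (U : choiceType) (D : set U) (F : U -> set T) :
  countable D -> (forall i, measurable (F i)) ->
  measurable (\bigcup_(i in D) F i).
Proof.
move=> + mF.
have [->|/set0P[r Dr] /countable_injP[f injf]] := eqVneq D set0.
  by rewrite bigcup_set0.
rewrite -(injpinv_image (cst r) injf) bigcup_image.
by apply: bigcup_measurable => n _; exact: mF.
Qed.

Section inner_product.
Context (R : realType) (H : completeNormedModType R) (ip : {dot H for idfun}).
Hypothesis ip_norm : forall x : H, `|x| ^+ 2 = ip x x.

Lemma polarization (x y : H) :
  ip x y = 2^-1 * (`|x| ^+ 2 + `|y| ^+ 2 - `|x - y| ^+ 2).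
Proof.
rewrite !ip_norm hnormB /= expr0 mul1r.
by rewrite subKr; field.
Qed.

Lemma cauchy_schwarz (x y : H) : `|ip x y| <= `|x| * `|y|.
Proof.
suff le u v : ip u v <= `|u| * `|v|.
  rewrite ler_norml le andbT lerNl -linearNl.
  by have := le (- x) y; rewrite normrN.
rewrite polarization.
have : (`|u| - `|v|) ^+ 2 <= `|u - v| ^+ 2.
  by rewrite -[leLHS]real_normK ?num_real// ler_sqr ?nnegrE ?ler_dist_dist.
by rewrite sqrrB -mulr_natl => h; lra.
Qed.

Lemma continuous_borel_measurable (f : H -> R) :
  continuous f -> measurable_fun [set: borel H] f.
Proof.
move=> cf; apply: (measurability _ (RGenOpens.measurableE R)).
move=> _ [_ [a [b ->] <-]]; rewrite setTI; apply: sub_sigma_algebra.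
by move/continuousP : cf; apply; exact: interval_open.
Qed.

Lemma measurable_dist (d : measure_display) (T : measurableType d)
    (U : T -> borel H) (y : H) :
  measurable_fun setT U -> measurable_fun setT (fun w => `|(U w : H) - y|).
Proof.
move=> mU.
apply: (measurableT_comp (f := fun x : borel H => `|(x : H) - y|)) => //.
apply: continuous_borel_measurable => x; apply: cvg_norm.
by apply: cvgB; [exact: cvg_id|exact: cvg_cst].
Qed.

(** The distance is a continuous function of two variables, but the pair (U, V)
is only known to be measurable for the product of the two Borel sigma-fields.
Separability bridges the gap: |U - V| < r holds exactly when some point y of a
countable dense set and some rational q satisfy |U - y| < q and |V - y| < r - q. *)
Lemma measurable_dist2 (d : measure_display) (T : measurableType d)
    (U V : T -> borel H) : separable H ->
  measurable_fun setT U -> measurable_fun setT V ->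
  measurable_fun setT (fun w => `|(U w : H) - (V w : H)|).
Proof.
move=> [D [cD dD]] mU mV.
apply: (measurability _ (RGenInftyO.measurableE R)).
move=> _ [_ [r ->] <-]; rewrite setTI.
pose W (y : H) := \bigcup_(q in [set: rat])
  ([set w | `|(U w : H) - y| < ratr q] `&` [set w | `|(V w : H) - y| < r - ratr q]).
have -> : (fun w => `|(U w : H) - (V w : H)|) @^-1` `]-oo, r[ = \bigcup_(y in D) W y.
  apply/seteqP; split => [w /=|w [y Dy [q _ [/= Uq Vq]]] /=].
    rewrite in_itv/= => Wr.
    (* With y within e of V w, the slack 3 e leaves room for q strictly between
       |U - V| + e, which exceeds |U - y|, and r - e. *)
    pose e := (r - `|(U w : H) - (V w : H)|) / 3.
    have e0 : 0 < e by rewrite divr_gt0// subr_gt0.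
    have [y [yV Dy]] : (ball (V w : H) e) `&` D !=set0.
      apply: dD; last exact: ball_open.
      by exists (V w); exact: ballxx.
    move: yV; rewrite -ball_normE /= => yV.
    have /rat_in_itvoo[q] : `|(U w : H) - (V w : H)| + e < r - e.
      by rewrite /e in e0 *; lra.
    rewrite in_itv/= => /andP[q1 q2].
    exists y => //; exists q => //; split => /=.
      by apply: le_lt_trans q1; rewrite (le_trans (ler_distD (V w : H) _ _))// lerD2l ltW.
    by rewrite (lt_trans yV)// ltrBrDr addrC -ltrBrDr.
  rewrite in_itv/=; apply: le_lt_trans (ler_distD y _ _) _.
  by rewrite [X in _ + X]distrC; lra.
have cW : forall y, measurable (W y).
  move=> y; apply: bigcupT_measurable_rat => q; apply: measurableI;
    apply: measurable_pred; apply: measurable_fun_ltr => //; exact: measurable_dist.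
exact: countable_bigcup_measurable.
Qed.

(** Polarization writes the inner product in terms of three norms. *)
Lemma measurable_inner_product (d : measure_display) (T : measurableType d)
    (U V : T -> borel H) : separable H ->
  measurable_fun setT U -> measurable_fun setT V ->
  measurable_fun setT (fun w => ip (U w) (V w)).
Proof.
move=> sH mU mV; under eq_fun do rewrite polarization.
have nrm (W : T -> borel H) : measurable_fun setT W ->
    measurable_fun setT (fun w => `|(W w : H)|).
  by move=> /(measurable_dist 0); under eq_fun do rewrite subr0.
apply: measurable_funM => //; apply: measurable_funB; last first.
  by apply: measurable_funX; exact: measurable_dist2.
by apply: measurable_funD; apply: measurable_funX; exact: nrm.
Qed.

End inner_product.

(** * Chebyshev's inequality for relative frequencies *)

Definition freq (R : realType) (I : finType) (J : {pred I}) (b : I -> bool) : R :=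
  #|J|%:R^-1 * \sum_(i in J) (b i)%:R.

Lemma measurable_count (d : measure_display) (T : measurableType d) (R : realType)
    (I : finType) (J : {pred I}) (b : I -> T -> bool) :
  (forall i, measurable_fun setT (b i)) ->
  measurable_fun setT (fun w => \sum_(i in J) (b i w)%:R : R).
Proof.
move=> mb; rewrite (_ : (fun w => _) =
    (fun w => \sum_(i <- enum J) (if b i w then 1 else 0))); last first.
  by apply/funext => w; rewrite big_enum; apply: eq_bigr => i _; case: (b i w).
by apply: measurable_sum => i; exact: measurable_fun_ifT.
Qed.

Lemma measurable_freq (d : measure_display) (T : measurableType d) (R : realType)
    (I : finType) (J : {pred I}) (b : I -> T -> bool) :
  (forall i, measurable_fun setT (b i)) ->
  measurable_fun setT (fun w => freq R J (b^~ w)).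
Proof. by move=> mb; apply: measurable_funM => //; exact: measurable_count. Qed.

Section variance_of_sums.
Context (d : measure_display) (T : measurableType d) (R : realType)
  (P : probability T R).

Lemma Lfun_indic (A : set T) : measurable A -> (\1_A : T -> R) \in Lfun P 2%:E.
Proof.
move=> mA; rewrite inE/=; apply/andP; split; rewrite inE//=.
rewrite /finite_norm unlock poweR_lty//.
have -> : (fun x => (`|(\1_A x)%:E| `^ 2)%E) = (EFin \o (\1_A : T -> R)) :> (T -> \bar R).
  apply/funext => x /=.
  by rewrite indicE; case: (x \in A); rewrite ?normr1 ?normr0 ?powR1 ?powR0.
by apply: integrable_lty => //; exact: integrable_indic.
Qed.

Lemma covariance_indic (A B : set T) : measurable A -> measurable B ->
  covariance P \1_A \1_B = (P (A `&` B) - P A * P B)%E.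
Proof.
move=> mA mB; have Pfin : P setT \is a fin_num := fin_num_measure P _ measurableT.
have A2 := Lfun_indic mA; have B2 := Lfun_indic mB.
rewrite covarianceE ?(Lfun2_mul_Lfun1 A2 B2) ?(Lfun_subset12 Pfin A2)
  ?(Lfun_subset12 Pfin B2)//.
rewrite !expectation_indic// -[(_ * _)%R]/(\1_A \* \1_B)%R -indicI.
by rewrite expectation_indic//; exact: measurableI.
Qed.

(** Bienayme's identity. *)
Lemma variance_sum_uncorrelated (I : eqType) (s : seq I) (f : I -> T -> R) :
  (forall i, f i \in Lfun P 2%:E) -> uniq s ->
  (forall i j, i \in s -> j \in s -> i != j -> covariance P (f i) (f j) = 0%E) ->
  variance P (\sum_(i <- s) f i) = (\sum_(i <- s) variance P (f i))%E.
Proof.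
move=> f2; elim: s => [|i s IHs] /=; first by rewrite !big_nil variance_cst.
move=> /andP[i_s s_uniq] cov0; rewrite !big_cons.
have sum2 (r : seq I) : \sum_(j <- r) f j \in Lfun P 2%:E.
  by rewrite rpred_sum ?lee1n.
rewrite -IHs//; last by move=> j k js ks; apply: cov0; rewrite inE ?js ?ks orbT.
rewrite varianceD ?lee1n//.
suff -> : covariance P (f i) (\sum_(j <- s) f j) = 0%E by rewrite mule0 adde0.
have : {subset s <= i :: s} by move=> j js; rewrite inE js orbT.
elim: {IHs s_uniq} s i_s cov0 => [|j s IHs]; first by rewrite big_nil covariance_cst_r.
rewrite inE negb_or => /andP[ij i_s] cov0 sub.
rewrite big_cons covarianceDr// cov0 ?mem_head ?inE ?eqxx ?orbT// add0e.
rewrite IHs//; last by move=> k ks; rewrite inE ks orbT.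
move=> k l ki li; apply: cov0.
  by move: ki; rewrite !inE => /orP[->//|->]; rewrite !orbT.
by move: li; rewrite !inE => /orP[->//|->]; rewrite !orbT.
Qed.

(** Indicators of pairwise independent events are uncorrelated and have variance
at most 1, so that the variance of their mean is at most 1 / #|J|. *)
Lemma freq_chebyshev (I : finType) (J : {pred I}) (b : I -> T -> bool) (p eta : R) :
  (forall i, measurable_fun setT (b i)) ->
  (forall i, i \in J -> P [set w | b i w] = p%:E) ->
  (forall i j, i \in J -> j \in J -> i != j ->
    P [set w | b i w && b j w] = (p * p)%:E) ->
  (0 < #|J|)%N -> 0 < eta ->
  (P [set w | (eta < `|freq R J (b^~ w) - p|)%R]
     <= ((eta ^+ 2 * #|J|%:R)^-1)%:E)%E.
Proof.
move=> mb Pb Pbb J0 eta0; set m : R := #|J|%:R.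
have m0 : 0 < m by rewrite ltr0n.
pose E i := [set w | b i w].
have mE i : measurable (E i) by exact: measurable_pred.
pose S : T -> R := \sum_(i <- enum J) \1_(E i).
have S2 : S \in Lfun P 2%:E.
  by apply: rpred_sum; rewrite ?lee1n// => ? i _; exact: Lfun_indic.
have Pfin : P setT \is a fin_num := fin_num_measure P _ measurableT.
pose X := m^-1 \o* S.
have mX : measurable_fun setT X.
  have : X \in Lfun P 2%:E by rewrite Lfun_scale ?ler1n.
  by rewrite inE => /andP[]; rewrite inE.
have XE w : X w = freq R J (b^~ w).
  rewrite /X /freq /= mulrC; congr (_ * _); rewrite /S fct_sumE big_enum/=.
  apply: eq_bigr => i _; rewrite indicE; congr (_%:R).
  by congr nat_of_bool; apply/idP/idP; rewrite inE.
have EX : ('E_P[X] = p%:E)%E.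
  rewrite expectationZl ?(Lfun_subset12 Pfin)//.
  have -> : S = \sum_(f <- [seq \1_(E i) | i <- enum J]) f by rewrite big_map.
  rewrite expectation_sum; last first.
    by move=> _ /mapP[i _ ->]; rewrite (Lfun_subset12 Pfin)// Lfun_indic.
  rewrite big_map (eq_big_seq (fun=> p%:E)); last first.
    by move=> i; rewrite mem_enum => iJ; rewrite expectation_indic// Pb.
  rewrite sumEFin big_const_seq count_predT -cardE iter_addr addr0 -EFinM.
  by rewrite -mulr_natl mulKf ?gt_eqF.
have VS : (variance P S <= m%:E)%E.
  rewrite variance_sum_uncorrelated ?enum_uniq//; last 2 first.
  - by move=> i; exact: Lfun_indic.
  - move=> i j; rewrite !mem_enum => iJ jJ ij; rewrite covariance_indic//.
    rewrite (_ : E i `&` E j = [set w | b i w && b j w]); last first.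
      by apply/seteqP; split => w /= /andP.
    by rewrite Pbb// !Pb// -EFinM subee.
  have -> : m%:E = (\sum_(i <- enum J) 1)%E.
    by rewrite sumEFin big_const_seq count_predT -cardE iter_addr addr0.
  apply: lee_sum => i _; rewrite /variance covariance_indic// setIid.
  rewrite (@le_trans _ _ (P (E i)))// ?probability_le1//.
  by rewrite -[leRHS]adde0 leeD2l// oppe_le0 mule_ge0.
pose Xrv : {RV P >-> R} := mfun_Sub (mem_set mX).
have := @chebyshev _ _ _ P Xrv _ eta0.
rewrite /= EX/= => cheb; apply: (@le_trans _ _ (P [set w | (eta <= `|X w - p|)%R])).
  have mXp : measurable_fun setT (fun w => `|X w - p|).
    by apply: measurableT_comp => //; exact: measurable_funB.
  apply: le_measure; rewrite ?inE.
  - by under eq_set do rewrite -XE; exact: measurable_ltr_set.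
  - by apply: measurable_pred; exact: measurable_fun_ler.
  - by move=> w /=; rewrite -XE => /ltW.
apply: (le_trans cheb); rewrite varianceZ//.
have -> : (((eta ^+ 2 * m)^-1)%:E = (eta ^- 2)%:E * ((m^-1 ^+ 2)%:E * m%:E))%E.
  by rewrite -!EFinM; congr EFin; field; rewrite !gt_eqF.
apply: lee_wpmul2l; first by rewrite lee_fin invr_ge0 exprn_ge0// ltW.
by apply: lee_wpmul2l => //; rewrite lee_fin exprn_ge0// invr_ge0 ltW.
Qed.

End variance_of_sums.

(** * Weak law and stability of the empirical distribution function *)

Section vanishing_events.
Context (d : measure_display) (T : measurableType d) (R : realType)
  (P : probability T R).

(** Measurability is part of the notion because P is monotone and subadditive on
measurable sets only. *)
Definition vanishing (A : nat -> set T) : Prop :=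
  (forall n, measurable (A n)) /\ P (A n) @[n --> \oo] --> 0%E.

Lemma vanishingU (A B : nat -> set T) :
  vanishing A -> vanishing B -> vanishing (fun n => A n `|` B n).
Proof.
move=> [mA A0] [mB B0]; split=> [n|]; first exact: measurableU.
apply: (@squeeze_cvge _ _ _ _ (cst 0%E) _ (fun n => P (A n) + P (B n))%E).
- by apply: nearW => n; rewrite measure_ge0 measureU2.
- exact: cvg_cst.
- by rewrite -[X in _ --> X]adde0; apply: cvgeD.
Qed.

Lemma vanishing_sub (A B : nat -> set T) : (forall n, measurable (A n)) ->
  (\forall n \near \oo, A n `<=` B n) -> vanishing B -> vanishing A.
Proof.
move=> mA AB [mB B0]; split => //.
apply: (@squeeze_cvge _ _ _ _ (cst 0%E) _ (P \o B)) => //; last exact: cvg_cst.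
near=> n; rewrite measure_ge0 le_measure ?inE//.
by near: n.
Unshelve. all: by end_near. Qed.

Lemma vanishing_setC (A : nat -> set T) : (forall n, measurable (A n)) ->
  vanishing (fun n => ~` A n) -> P (A n) @[n --> \oo] --> 1%E.
Proof.
move=> mA [_ A0].
have -> : (fun n => P (A n)) = (fun n => 1 - P (~` A n))%E.
  by apply/funext => n; rewrite -probability_setC ?setCK//; exact: measurableC.
by rewrite -[X in _ --> X]sube0; apply: cvgeB => //; exact: cvg_cst.
Qed.

Lemma weak_law_freq (J : forall n, {pred 'I_n}) (b : forall n, 'I_n -> T -> bool)
    (p : R) :
  (forall n i, measurable_fun setT (b n i)) ->
  (forall n i, i \in J n -> P [set w | b n i w] = p%:E) ->
  (forall n i j, i \in J n -> j \in J n -> i != j ->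
    P [set w | b n i w && b n j w] = (p * p)%:E) ->
  (#|J n|%:R : R) @[n --> \oo] --> +oo ->
  forall eta, 0 < eta ->
    vanishing (fun n => [set w | eta < `|freq R (J n) (b n ^~ w) - p|]).
Proof.
move=> mb Pb Pbb Joo eta eta0; split=> [n|].
  apply/measurable_ltr_set/measurableT_comp/measurable_funB => //.
  exact: measurable_freq.
have Jpos : \forall n \near \oo, 0 < (#|J n|%:R : R).
  by move/cvgryPgt : Joo; exact.
apply: (@squeeze_cvge _ _ _ _ (cst 0%E) _
    (fun n => ((eta ^+ 2 * #|J n|%:R)^-1)%:E)).
- near=> n; rewrite measure_ge0/=; apply: freq_chebyshev => //.
  + exact: Pb.
  + exact: Pbb.
  + by rewrite -(ltr0n R); near: n.
- exact: cvg_cst.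
- apply: cvg_EFin; first exact: nearW.
  apply/(gtr0_cvgV0 (f := fun n => eta ^+ 2 * #|J n|%:R)).
    by near=> n; rewrite mulr_gt0 ?exprn_gt0//; near: n.
  apply/cvgryPge => A; near=> n.
  rewrite mulrC -ler_pdivrMr ?exprn_gt0//.
  by near: n; move/cvgryPge : Joo; exact.
Unshelve. all: by end_near. Qed.

End vanishing_events.

Lemma freq_le (R : realType) (I : finType) (J : {pred I}) (b c a : I -> bool) :
  (forall i, i \in J -> b i -> c i || a i) ->
  freq R J b <= freq R J c + freq R J a.
Proof.
move=> bca; rewrite /freq -mulrDr ler_wpM2l ?invr_ge0//.
rewrite -big_split/=; apply: ler_sum => i /bca.
by rewrite -natrD ler_nat; case: (b i); case: (c i); case: (a i) => //= /(_ isT).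
Qed.

Lemma freq01 (R : realType) (I : finType) (J : {pred I}) (b : I -> bool) :
  0 <= freq R J b <= 1.
Proof.
apply/andP; split; first by rewrite mulr_ge0 ?invr_ge0// sumr_ge0.
rewrite /freq; have [J0|J0] := posnP #|J|; first by rewrite J0 invr0 mul0r.
rewrite mulrC ler_pdivrMr ?ltr0n// mul1r -sum1_card natr_sum.
by apply: ler_sum => i _; rewrite ler_nat leq_b1.
Qed.

Section stability_of_empirical_cdf.
Context (d : measure_display) (T : measurableType d) (R : realType)
  (P : probability T R).

Definition pairwise_independent (I : Type) (J : I -> bool) (Z : I -> T -> R) :=
  forall i j, J i -> J j -> i <> j -> forall A : set R, measurable A ->
    P (Z i @^-1` A `&` Z j @^-1` A) = (P (Z i @^-1` A) * P (Z j @^-1` A))%E.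

Lemma weak_law_preimage (J : forall n, {pred 'I_n})
    (Z : forall n, 'I_n -> T -> R) (b : R -> bool) (p : R) :
  (forall n i, measurable_fun setT (Z n i)) -> measurable_fun setT b ->
  (forall n, pairwise_independent (mem (J n)) (Z n)) ->
  (forall n i, i \in J n -> P [set w | b (Z n i w)] = p%:E) ->
  (#|J n|%:R : R) @[n --> \oo] --> +oo ->
  forall eta, 0 < eta -> vanishing P
    (fun n => [set w | eta < `|freq R (J n) (fun i => b (Z n i w)) - p|]).
Proof.
move=> mZ mb Zind Pb Joo eta eta0.
apply: (weak_law_freq (b := fun n i w => b (Z n i w))) => //.
- by move=> n i; exact: measurableT_comp.
- move=> n i j iJ jJ ij.
  have := Zind n i j iJ jJ (elimN eqP ij) _ (measurable_pred mb).
  rewrite (_ : _ `&` _ = [set w | b (Z n i w) && b (Z n j w)]); last first.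
    by apply/seteqP; split => w /= /andP.
  by move=> ->; rewrite EFinM; congr (_ * _)%E; exact: Pb.
Qed.

(** The sandwich argument. In the application r is the residual, e the error, x the
norm of the covariate, and a, b are the two estimation errors. If a and b are at
most c = delta / (1 + M), then |r - e| <= delta for every index with x <= M, so the
implications e <= z - delta -> r <= z -> e <= z + delta can fail only where x > M. *)
Lemma freq_perturbed_cvg (J : forall n, {pred 'I_n})
    (e r x : forall n, 'I_n -> T -> R) (a b : nat -> T -> R) (F tau : R -> R)
    (z : R) :
  (forall n i, measurable_fun setT (e n i)) ->
  (forall n i, measurable_fun setT (r n i)) ->
  (forall n i, measurable_fun setT (x n i)) ->
  (forall n i w, `|r n i w - e n i w| <= a n w + x n i w * b n w) ->
  (forall n i w, 0 <= x n i w) -> (forall n w, 0 <= b n w) ->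
  (forall c, 0 < c -> vanishing P (fun n => [set w | c < a n w])) ->
  (forall c, 0 < c -> vanishing P (fun n => [set w | c < b n w])) ->
  (#|J n|%:R : R) @[n --> \oo] --> +oo ->
  (forall n, pairwise_independent (mem (J n)) (e n)) ->
  (forall n, pairwise_independent (mem (J n)) (x n)) ->
  (forall n i, i \in J n -> forall y, P [set w | e n i w <= y] = (F y)%:E) ->
  (forall n i, i \in J n -> forall M, P [set w | M < x n i w] = (tau M)%:E) ->
  (forall c, 0 < c -> exists2 M, 0 <= M & tau M <= c) ->
  {for z, continuous F} ->
  forall eta, 0 < eta -> vanishing P
    (fun n => [set w | eta < `|freq R (J n) (fun i => r n i w <= z) - F z|]).
Proof.
move=> me mr mx rex x0 b0 a_van b_van Joo eind xind eF xtau tau0 Fz eta eta0.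
have eta4 : 0 < eta / 4 by rewrite divr_gt0.
have [M M0 tauM] := tau0 _ eta4.
have [dl dl0 Fdl] : exists2 dl, 0 < dl &
    forall y, `|y - z| <= dl -> `|F y - F z| <= eta / 4.
  have /cvgrPdist_le /(_ _ eta4) := Fz.
  move=> /nbhs_ballP[dl /= dl0 h]; exists (dl / 2); first by rewrite divr_gt0.
  move=> y yz; rewrite distrC; apply: h; rewrite /ball/= distrC.
  by rewrite (le_lt_trans yz)// gtr_pMr// invf_lt1// ltr1n.
(* With this c, the bound c + M * c on |r - e| is exactly dl. *)
pose c := dl / (1 + M).
have M1 : 0 < 1 + M by rewrite ltr_pwDl.
have c0 : 0 < c by rewrite divr_gt0.
have mle y : measurable_fun setT (fun t : R => t <= y) by exact: measurable_fun_ler.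
have mlt y : measurable_fun setT (fun t : R => y < t) by exact: measurable_fun_ltr.
have evan y := weak_law_preimage me (mle y) eind (fun n i iJ => eF n i iJ y) Joo eta4.
have xvan := weak_law_preimage mx (mlt M) xind (fun n i iJ => xtau n i iJ M) Joo eta4.
have mfr n : measurable_fun setT (fun w => freq R (J n) (fun i => r n i w <= z)).
  apply: (@measurable_freq _ _ _ _ (J n) (fun i w => r n i w <= z)) => i.
  exact: measurable_fun_ler.
have bad := vanishingU (vanishingU (a_van _ c0) (b_van _ c0))
  (vanishingU (vanishingU (evan (z + dl)) (evan (z - dl))) xvan).
apply: vanishing_sub bad.
  by move=> n; apply/measurable_ltr_set/measurableT_comp => //; exact: measurable_funB.
(* Outside the bad event the error adds up to eta: eta / 4 for the continuity
   of F, eta / 4 for the weak law of e, and eta / 2 for the indices with x > M. *)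
apply: nearW => n w /=; apply: contraPP => /not_orP[/not_orP[aw bw]].
move=> /not_orP[/not_orP[e1 e2] x1].
move: aw bw e1 e2 x1 => /negP + /negP + /negP + /negP + /negP; rewrite -!leNgt.
move=> aw bw e1 e2 x1; apply/negP; rewrite -leNgt.
have close i : ~~ (M < x n i w) -> `|r n i w - e n i w| <= dl.
  rewrite -leNgt => xM; apply: (le_trans (rex _ _ _)).
  rewrite (_ : dl = c + M * c); last by rewrite /c; field; rewrite gt_eqF.
  by apply: lerD => //; exact: ler_pM.
have up : freq R (J n) (fun i => r n i w <= z) <=
    freq R (J n) (fun i => e n i w <= z + dl) + freq R (J n) (fun i => M < x n i w).
  apply: freq_le => i _ rz; case: (boolP (M < x n i w)) => [|/close]; rewrite ?orbT//.
  by rewrite ler_norml orbF => /andP[? ?]; lra.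
have lo : freq R (J n) (fun i => e n i w <= z - dl) <=
    freq R (J n) (fun i => r n i w <= z) + freq R (J n) (fun i => M < x n i w).
  apply: freq_le => i _ rz; case: (boolP (M < x n i w)) => [|/close]; rewrite ?orbT//.
  by rewrite ler_norml orbF => /andP[? ?]; lra.
have := Fdl (z + dl); have := Fdl (z - dl).
rewrite addrAC subrr add0r addrAC subrr add0r normrN gtr0_norm//.
move=> /(_ (lexx _)) F2 /(_ (lexx _)) F1.
move: e1 e2 x1 F1 F2; rewrite !ler_norml.
move=> /andP[? ?] /andP[? ?] /andP[? ?] /andP[? ?] /andP[? ?].
by apply/andP; split; lra.
Qed.

End stability_of_empirical_cdf.

(** * The test statistic *)

Definition before (n k : nat) : {pred 'I_n} := [pred i : 'I_n | (i < k)%N].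
Definition after (n k : nat) : {pred 'I_n} := [pred i : 'I_n | (k <= i)%N].
Arguments before : clear implicits.
Arguments after : clear implicits.

Lemma card_before (n k : nat) : (k <= n)%N -> #|before n k| = k.
Proof.
move=> kn; rewrite -sum1_card -[RHS]card_ord -sum1_card.
by rewrite [RHS](big_ord_widen _ (fun=> 1%N) kn).
Qed.

Lemma card_after (n k : nat) : (k <= n)%N -> #|after n k| = (n - k)%N.
Proof.
move=> kn; rewrite -[in RHS](card_ord n) -(cardC (before n k)).
rewrite card_before// addKn.
by apply: eq_card => i; rewrite !inE -leqNgt.
Qed.

Lemma Fhat_freq (R : realType) (n : nat) (e : 'I_n -> R) (k : nat) (z : R) :
  (k <= n)%N -> Fhat e k z = freq R (before n k) (fun i => e i <= z).
Proof. by move=> kn; rewrite /freq card_before. Qed.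

Lemma Ftilde_freq (R : realType) (n : nat) (e : 'I_n -> R) (k : nat) (z : R) :
  (k <= n)%N -> Ftilde e k z = freq R (after n k) (fun i => e i <= z).
Proof. by move=> kn; rewrite /freq card_after. Qed.

Section statistic.
Context (R : realType) (n : nat).
Implicit Types (e : 'I_n -> R) (t z q : R).

(** The time t enters the process only through the integer part k of n t. *)
Definition cusum e (k : nat) z : R :=
  (k * (n - k))%:R / n%:R `^ (3 / 2) * (Fhat e k z - Ftilde e k z).

Lemma truncn_time_le t : 0 <= t <= 1 -> (Num.truncn (n%:R * t) <= n)%N.
Proof.
move=> /andP[t0 t1]; rewrite -(ler_nat R).
apply: (@le_trans _ _ (n%:R * t)); first by rewrite truncn_le mulr_ge0.
by rewrite ler_piMr.
Qed.

Lemma Ghat_bounded e t z : 0 <= t <= 1 ->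
  `|Ghat e t z| <= (n * n)%:R / n%:R `^ (3 / 2).
Proof.
move=> /truncn_time_le kn.
rewrite /Ghat Fhat_freq// Ftilde_freq// normrM.
rewrite ger0_norm ?divr_ge0 ?powR_ge0//.
rewrite -[leRHS]mulr1 ler_pM ?divr_ge0 ?powR_ge0//.
  by rewrite ler_wpM2r ?invr_ge0 ?powR_ge0// ler_nat leq_mul// leq_subr.
have /andP[a0 a1] := freq01 R (before n (Num.truncn (n%:R * t))) (fun i => e i <= z).
have /andP[b0 b1] := freq01 R (after n (Num.truncn (n%:R * t))) (fun i => e i <= z).
by rewrite ler_norml; apply/andP; split; lra.
Qed.

(** The process is bounded, so both suprema are genuine least upper bounds rather
than the default value of an unbounded set. *)
Lemma lt_Tstat e q :
  q < Tstat e <-> exists t z, 0 <= t <= 1 /\ q < `|Ghat e t z|.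
Proof.
pose C : R := (n * n)%:R / n%:R `^ (3 / 2).
have ubz t : 0 <= t <= 1 -> ubound [set `|Ghat e t z| | z in [set: R]] C.
  by move=> t01 _ [z _ <-]; exact: Ghat_bounded.
have nez t : [set `|Ghat e t z| | z in [set: R]] !=set0.
  by exists `|Ghat e t 0|; exists 0.
have ubt : ubound [set sup [set `|Ghat e t z| | z in [set: R]] | t in `[0, 1]] C.
  by move=> _ [t t01 <-]; apply: ge_sup => //; apply: ubz; rewrite /= in_itv in t01.
split.
  move=> /sup_gt[|_ [t t01 <-] /sup_gt[//|_ [z _ <-] qG]].
    exists (sup [set `|Ghat e 0 z| | z in [set: R]]), 0 => //=.
    by rewrite in_itv/= lexx ler01.
  by exists t, z; split => //; rewrite /= in_itv in t01.
move=> [t [z [t01 qG]]]; apply: (lt_le_trans qG).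
apply: (@le_trans _ _ (sup [set `|Ghat e t z| | z in [set: R]])).
  by apply: ub_le_sup; [exists C; exact: ubz|exists z].
by apply: ub_le_sup; [exists C|exists t => //=; rewrite in_itv].
Qed.

(** As a function of z the process only jumps at sample points: replacing z by the
largest sample point below it changes no indicator. Left of all sample points the
process is 0. *)
Lemma cusum_attained e (k : nat) z q : 0 <= q -> q < `|cusum e k z| ->
  exists j, q < `|cusum e k (e j)|.
Proof.
move=> q0 qz.
have [[i ez]|none] := pselect (exists i, e i <= z).
  pose j := [arg max_(j > i | e j <= z) e j]%O.
  have : e j <= z /\ forall l, e l <= z -> e l <= e j.
    by rewrite /j; case: arg_maxP.
  move=> [jz jmax]; exists j.
  have same l : (e l <= e j) = (e l <= z).
    by apply/idP/idP => [lj|/jmax//]; exact: le_trans jz.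
  rewrite /cusum /Fhat /Ftilde.
  by under eq_bigr do rewrite same; under [X in _ - _ * X]eq_bigr do rewrite same.
have none' i : (e i <= z) = false by apply/negP => ez; apply: none; exists i.
move: qz; rewrite /cusum /Fhat /Ftilde !big1 ?mulr0 ?subrr ?mulr0 ?normr0.
- by rewrite ltNge q0.
- by move=> i _; rewrite none'.
- by move=> i _; rewrite none'.
Qed.

(** Both suprema reduce to countable unions: over the integer parts k and, by
[cusum_attained], over the sample points. *)
Lemma measurable_lt_Tstat (d : measure_display) (T : measurableType d)
    (e : T -> 'I_n -> R) (q : R) : 0 <= q ->
  (forall i, measurable_fun setT (e^~ i)) ->
  measurable [set w | q < Tstat (e w)].
Proof.
move=> q0 me.
pose K := [set k | exists2 t : R, 0 <= t <= 1 & k = Num.truncn (n%:R * t)].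
rewrite (_ : [set _ | _] = \bigcup_(k in K) \bigcup_(j in [set: 'I_n])
    [set w | q < `|cusum (e w) k (e w j)|]); last first.
  apply/seteqP; split => [w /lt_Tstat[t [z [t01 qG]]]|w [k [t t01 ->]] [j _ qj]].
    exists (Num.truncn (n%:R * t)); first by exists t.
    by have [j qj] := cusum_attained q0 qG; exists j.
  by apply/lt_Tstat; exists t, (e w j).
apply: countable_bigcup_measurable; [exact: countableP|move=> k].
apply: countable_bigcup_measurable; [exact: countableP|move=> j].
have mF (A : {pred 'I_n}) :
    measurable_fun setT (fun w => \sum_(i in A) (e w i <= e w j)%R%:R : R).
  apply: (@measurable_count _ _ _ _ A (fun i w => e w i <= e w j)) => i.
  exact: measurable_fun_ler.
apply: measurable_ltr_set; apply: measurableT_comp => //.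
apply: measurable_funM => //.
apply: measurable_funB; apply: measurable_funM => //.
  exact: (mF (before n k)).
exact: (mF (after n k)).
Qed.

End statistic.

(** From k <= n theta < k + 1 follow n - k >= n (1 - theta) and, as soon as
n theta >= 2, k >= n theta / 2. *)
Lemma weight_ge (R : realType) (theta : R) (n : nat) : 0 < theta < 1 ->
  2 <= n%:R * theta ->
  let k := change_point theta n in
  Num.sqrt n%:R * (theta * (1 - theta) / 2) <= (k * (n - k))%:R / n%:R `^ (3 / 2).
Proof.
move=> /andP[t0 t1] nt /=; set k := change_point _ _.
have n0 : 0 < n%:R :> R.
  by rewrite ltNge; apply/negP => n0; have := mulr_le0_ge0 n0 (ltW t0); lra.
have /truncn_itv/andP[k1 k2] : 0 <= n%:R * theta by lra.
rewrite -/(change_point theta n) -/k in k1 k2.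
have kn : (k <= n)%N by rewrite -(ler_nat R) (le_trans k1)// ler_piMr ?ltW.
rewrite (_ : 3 / 2 = 1 + 2^-1 :> R); last by field.
rewrite powRD ?powRr1 ?powR12_sqrt ?(ltW n0)//; last by rewrite gt_eqF ?implybT.
have s0 : 0 < Num.sqrt (n%:R : R) by rewrite sqrtr_gt0.
rewrite ler_pdivlMr ?mulr_gt0// natrM natrB//.
have sE : Num.sqrt (n%:R : R) * Num.sqrt n%:R = n%:R by rewrite -expr2 sqr_sqrtr ?ltW.
have square (s m : R) : s * s = m -> s * (theta * (1 - theta) / 2) * (m * s) =
  m * theta / 2 * (m * (1 - theta)) by move=> <-; field.
rewrite (square _ _ sE).
apply: ler_pM; rewrite ?mulr_ge0 ?subr_ge0 ?(ltW t0) ?(ltW t1)//.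
  by rewrite -addn1 natrD in k2; lra.
lra.
Qed.

(** * Independence, tightness, and the size of the statistic *)

(** The product rule for the pair i, j is the rule for the full family with the
whole space at every other index. *)
Lemma mutually_independent_pairwise (d d' : measure_display)
    (T : measurableType d) (S : measurableType d') (R : realType)
    (P : probability T R) (I : finType) (J : I -> bool) (Z : I -> T -> S)
    (f : S -> R) :
  mutually_independent P Z -> measurable_fun setT f ->
  pairwise_independent P J (fun i => f \o Z i).
Proof.
move=> Zind mf i j _ _ /eqP ij A mA.
pose B k : set S := if (k == i) || (k == j) then f @^-1` A else setT.
have mB k : measurable (B k).
  by rewrite /B; case: ifP => // _; rewrite -[X in measurable X]setTI; exact: mf.
have Bi : B i = f @^-1` A by rewrite /B eqxx.
have Bj : B j = f @^-1` A by rewrite /B eqxx orbT.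
have := Zind B mB.
rewrite (bigD1 i)//= (bigD1 j) 1?eq_sym//= big1 ?mule1; last first.
  move=> k /andP[/negPf ki /negPf kj].
  by rewrite /B ki kj preimage_setT probability_setT.
rewrite Bi Bj => prodE; apply: etrans prodE; congr (P _).
apply/seteqP; split => w /=.
  by move=> [Ai Aj] k; rewrite /B; case: ifP => //= /orP[] /eqP ->.
by move=> h; have := h i; have := h j; rewrite Bi Bj.
Qed.

(** A real random variable is tight: its complementary distribution function
tends to 0 at infinity. *)
Lemma tail_small (d : measure_display) (S : measurableType d) (R : realType)
    (Q : probability S R) (f : S -> R) : measurable_fun setT f ->
  forall c, 0 < c -> exists2 M, 0 <= M & fine (Q [set s | M < f s]) <= c.
Proof.
move=> mf c c0.
pose X : {RV Q >-> R} := mfun_Sub (mem_set mf).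
have /fine_cvgP[_ /cvgrPdist_le /(_ _ c0) tail] := cvg_ccdfy0 X.
have [M [M0 MX]] : exists M : R, 0 <= M /\ `|0 - fine (ccdf X M)| <= c.
  near (pinfty_nbhs R) => M; exists M; split; near: M => //.
  exact: nbhs_pinfty_ge.
exists M => //; apply: le_trans MX; rewrite sub0r normrN ger0_norm ?fine_ge0//.
rewrite (_ : ccdf X M = Q [set s | M < f s])// /ccdf /distribution /pushforward.
by congr (Q _); apply/seteqP; split => s /=; rewrite in_itv/= andbT.
Unshelve. all: by end_near. Qed.

Lemma hoelder_continuous_continuous (R : realType) (F : R -> R) (gamma c : R) :
  0 < gamma -> hoelder_continuous F gamma c -> continuous F.
Proof.
move=> g0 HF z; apply/cvgrPdist_le => e e0.
(* Replacing c by a positive constant allows the division in dl. *)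
pose C := Num.max c 1.
have C0 : 0 < C by rewrite lt_max ltr01 orbT.
pose dl := (e / C) `^ gamma^-1.
have dl0 : 0 < dl by rewrite powR_gt0// divr_gt0.
near=> y; apply: (le_trans (HF z y)).
apply: (@le_trans _ _ (C * `|z - y| `^ gamma)).
  by rewrite ler_wpM2r ?powR_ge0// le_max lexx.
rewrite mulrC -ler_pdivlMr//.
rewrite [leRHS](_ : _ = dl `^ gamma); last first.
  by rewrite /dl -powRrM mulVf ?gt_eqF// powRr1// ltW// divr_gt0.
apply: ge0_ler_powR; rewrite ?nnegrE; [exact: ltW|by []|exact: ltW|].
by apply: ltW; near: y; exists dl.
Unshelve. all: by end_near. Qed.

Lemma change_point_le (R : realType) (theta : R) (n : nat) :
  0 < theta < 1 -> (change_point theta n <= n)%N.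
Proof. by move=> /andP[t0 t1]; apply: truncn_time_le; rewrite !ltW. Qed.

Lemma card_before_cvg (R : realType) (theta : R) : 0 < theta < 1 ->
  (#|before n (change_point theta n)|%:R : R) @[n --> \oo] --> +oo.
Proof.
move=> t01; have /andP[t0 t1] := t01; apply/cvgryPge => A; near=> n.
rewrite card_before ?change_point_le//.
have /truncn_itv/andP[_] : 0 <= n%:R * theta by rewrite mulr_ge0// ltW.
rewrite -/(change_point theta n) -addn1 natrD.
have : (A + 1) / theta <= n%:R by near: n; exact: nbhs_infty_ger.
by rewrite ler_pdivrMr//; lra.
Unshelve. all: by end_near. Qed.

Lemma card_after_cvg (R : realType) (theta : R) : 0 < theta < 1 ->
  (#|after n (change_point theta n)|%:R : R) @[n --> \oo] --> +oo.
Proof.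
move=> t01; have /andP[t0 t1] := t01; apply/cvgryPge => A; near=> n.
rewrite card_after ?change_point_le// natrB ?change_point_le//.
have /truncn_itv/andP[+ _] : 0 <= n%:R * theta by rewrite mulr_ge0// ltW.
rewrite -/(change_point theta n).
have : A / (1 - theta) <= n%:R by near: n; exact: nbhs_infty_ger.
by rewrite ler_pdivrMr ?subr_gt0//; lra.
Unshelve. all: by end_near. Qed.

(** Two frequencies within |f1 - f2| / 4 of f1 and f2 are at least |f1 - f2| / 2
apart. *)
Lemma Tstat_large (R : realType) (theta : R) (n : nat) (e : 'I_n -> R)
    (z f1 f2 q : R) :
  let k := change_point theta n in
  0 < theta < 1 -> 2 <= n%:R * theta -> 0 < `|f1 - f2| ->
  q < Num.sqrt n%:R * (theta * (1 - theta) / 2) * (`|f1 - f2| / 2) ->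
  `|freq R (before n k) (fun i => e i <= z) - f1| <= `|f1 - f2| / 4 ->
  `|freq R (after n k) (fun i => e i <= z) - f2| <= `|f1 - f2| / 4 ->
  q < Tstat e.
Proof.
move=> k t01 nt D0 qn d1 d2; have /andP[t0 t1] := t01.
have kn : (k <= n)%N by exact: change_point_le.
apply/lt_Tstat; exists theta, z; split; first by rewrite !ltW.
rewrite /Ghat -/(change_point theta n) -/k Fhat_freq// Ftilde_freq//.
rewrite normrM ger0_norm ?divr_ge0 ?powR_ge0//.
apply: (lt_le_trans qn); apply: ler_pM; rewrite ?mulr_ge0 ?sqrtr_ge0 ?invr_ge0//.
- by rewrite ltW.
- by rewrite subr_ge0 ltW.
- exact: weight_ge.
move: d1 d2; set a := freq _ _ _; set b := freq _ _ _ => d1 d2.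
have := ler_distD a f1 f2; have := ler_distD b a f2.
by rewrite (distrC f1 a); lra.
Qed.

(** * Consistency *)

Lemma measurable_sample (R : realType) (H : completeNormedModType R)
    (d : measure_display) (T : measurableType d) (n : nat)
    (X : 'I_n -> T -> borel H) (Y : 'I_n -> T -> R) :
  (forall i, measurable_fun setT (X i)) -> (forall i, measurable_fun setT (Y i)) ->
  measurable_fun setT (sample X Y).
Proof.
move=> mX mY; apply/measurable_fun_tnthP => i.
rewrite (_ : _ \o _ = (fun w => (X i w, Y i w))).
  exact: measurable_fun_pair.
by apply/funext => w /=; rewrite tnth_mktuple.
Qed.

Theorem mainTheorem5 (R : realType)
  (* the separable Hilbert space *)
  (H : completeNormedModType R) (ip : {dot H for idfun})
  (ip_norm : forall x : H, `|x| ^+ 2 = ip x x)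
  (H_separable : separable H)
  (* the model; the i-th variable of the n-th sample is indexed from 0 *)
  (d : measure_display) (T : measurableType d) (P : probability T R)
  (theta : R) (theta01 : 0 < theta < 1)
  (alpha : R) (beta : H)
  (X : forall n, 'I_n -> {RV P >-> borel H})
  (Y : forall n, 'I_n -> {RV P >-> R})
  (eps : forall n, 'I_n -> {RV P >-> R})
  (model : forall n (i : 'I_n) w,
     Y n i w = alpha + ip (X n i w) beta + eps n i w)
  (XY_indep : forall n,
     mutually_independent P (fun (i : 'I_n) w => (X n i w, Y n i w)))
  (X_indep : forall n, mutually_independent P (X n))
  (X_id : forall n, identically_distributed P (X n))
  (X_moment : forall n (i : 'I_n),
     P.-integrable setT (fun w => `|X n i w : H|%:E))
  (eps_indep : forall n, mutually_independent P (eps n))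
  (eps_integrable : forall n (i : 'I_n), P.-integrable setT (EFin \o eps n i))
  (eps_centered : forall n (i : 'I_n), ('E_P[eps n i] = 0)%E)
  (X_eps_indep : forall n,
     independent P (fun w => [tuple X n i w | i < n])
                   (fun w => [tuple eps n i w | i < n]))
  (* the estimators *)
  (ahat : forall n, {mfun n.-tuple (borel H * R)%type >-> R})
  (bhat : forall n, {mfun n.-tuple (borel H * R)%type >-> borel H})
  (* (i) *)
  (ahat_consistent : cvg_in_probability0 P
     (fun n w => `|ahat n (sample (X n) (Y n) w) - alpha|))
  (bhat_consistent : cvg_in_probability0 P
     (fun n w => `|(bhat n (sample (X n) (Y n) w) : H) - beta|))
  (* (ii) *)
  (F1 F2 : R -> R) (gamma1 gamma2 c1 c2 : R)
  (eps_before : forall n (i : 'I_n), (i < change_point theta n)%N ->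
     forall z, cdf (eps n i) z = (F1 z)%:E)
  (eps_after : forall n (i : 'I_n), (change_point theta n <= i)%N ->
     forall z, cdf (eps n i) z = (F2 z)%:E)
  (F2_neq_F1 : F2 <> F1)
  (gamma1_bounds : 0 < gamma1 <= 1) (gamma2_bounds : 0 < gamma2 <= 1)
  (F1_hoelder : hoelder_continuous F1 gamma1 c1)
  (F2_hoelder : hoelder_continuous F2 gamma2 c2)
  (* (iii) *)
  (P1 P2 : probability (borel H * R)%type R)
  (law_before : forall n (i : 'I_n), (i < change_point theta n)%N ->
     has_law P (fun w => (X n i w, eps n i w)) P1)
  (law_after : forall n (i : 'I_n), (change_point theta n <= i)%N ->
     has_law P (fun w => (X n i w, eps n i w)) P2)
  (donsker_hyp : forall Q, Q = P1 \/ Q = P2 ->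
     exists B : set H,
       outer_probability P
         [set w | B ((bhat n (sample (X n) (Y n) w) : H) - beta)]
         @[n --> \oo] --> 1%E /\
       donsker Q (halfspace_class ip B)) :
  forall q : R, 0 < q ->
    P [set w | q < Tstat (residual ip (X n) (Y n) (ahat n) (bhat n) w)]
      @[n --> \oo] --> 1%E.
Proof.
move=> q q0.
have mbhat n : measurable_fun setT (fun w => bhat n (sample (X n) (Y n) w)).
  by apply: measurableT_comp => //; exact: measurable_sample.
have mahat n : measurable_fun setT (fun w => ahat n (sample (X n) (Y n) w)).
  by apply: measurableT_comp => //; exact: measurable_sample.
pose e n i w := residual ip (X n) (Y n) (ahat n) (bhat n) w i.
pose a n w := `|ahat n (sample (X n) (Y n) w) - alpha|.
pose b n w := `|(bhat n (sample (X n) (Y n) w) : H) - beta|.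
pose x n (i : 'I_n) w := `|(X n i w : H)|.
have me n i : measurable_fun setT (e n i).
  apply: measurable_funB; first exact: measurable_funB.
  exact: measurable_inner_product.
have mnorm : measurable_fun [set: borel H] (fun h : borel H => `|(h : H)|).
  by apply: continuous_borel_measurable; exact: norm_continuous.
have mx n i : measurable_fun setT (x n i) by exact: measurableT_comp.
have close n i w : `|e n i w - eps n i w| <= a n w + x n i w * b n w.
  rewrite /e /residual model.
  set u := ahat n _; set v := (bhat n _ : H).
  rewrite (_ : _ - _ = (alpha - u) + ip (X n i w) (beta - v)); last first.
    by rewrite linearBr; ring.
  apply: (le_trans (ler_normD _ _)); rewrite distrC lerD2l.
  by rewrite /b -/v distrC; exact: cauchy_schwarz.
have a_van c : 0 < c -> vanishing P (fun n => [set w | c < a n w]).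
  move=> c0; split.
    move=> n; apply/measurable_ltr_set/measurableT_comp => //.
    exact: measurable_funB.
  have := ahat_consistent c c0.
  by under eq_fun do under eq_set do rewrite normr_id.
have b_van c : 0 < c -> vanishing P (fun n => [set w | c < b n w]).
  move=> c0; split; first by move=> n; exact/measurable_ltr_set/measurable_dist.
  have := bhat_consistent c c0.
  by under eq_fun do under eq_set do rewrite normr_id.
(* A single point z at which the two distribution functions differ suffices. *)
have [z F12z] : exists z, F1 z <> F2 z.
  apply: contrapT => /forallNP F12; apply: F2_neq_F1.
  by apply/funext => z; apply: contrapT => F21; apply: (F12 z) => F12z; apply: F21.
have D0 : 0 < `|F1 z - F2 z| by rewrite normr_gt0 subr_eq0; exact/eqP.
set D := `|F1 z - F2 z| in D0.
(* Convergence of the residual frequency at z, for the sample before the change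
   and for the sample after it. *)
have block (J : forall n, {pred 'I_n}) (F : R -> R)
    (Q : probability (borel H * R)%type R) :
    (#|J n|%:R : R) @[n --> \oo] --> +oo ->
    (forall n i, i \in J n -> forall y, cdf (eps n i) y = (F y)%:E) ->
    (forall n i, i \in J n -> has_law P (fun w => (X n i w, eps n i w)) Q) ->
    continuous F ->
    vanishing P (fun n => [set w | D / 4 <
      `|freq R (J n) (fun i => e n i w <= z) - F z|]).
  move=> Joo eF law Fcont.
  pose N (p : borel H * R) := `|(p.1 : H)|.
  have mN : measurable_fun setT N by exact: measurableT_comp.
  apply: (freq_perturbed_cvg (e := fun n i => eps n i) (x := x) (a := a) (b := b)
    (tau := fun M => fine (Q [set p | M < N p]))) => //.
  - by move=> n i w; exact: normr_ge0.
  - by move=> n w; exact: normr_ge0.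
  - move=> n; apply: (mutually_independent_pairwise (f := id) (eps_indep n)).
    exact: measurable_id.
  - by move=> n; exact: (mutually_independent_pairwise (X_indep n) mnorm).
  - move=> n i iJ M; rewrite fineK ?fin_num_measure//; last exact: measurable_ltr_set.
    by rewrite -(law n i iJ)//; exact: measurable_ltr_set.
  - exact: tail_small.
  - exact: Fcont.
  - by rewrite divr_gt0.
have k_before n (i : 'I_n) : i \in before n (change_point theta n) ->
    (i < change_point theta n)%N by [].
have k_after n (i : 'I_n) : i \in after n (change_point theta n) ->
    (change_point theta n <= i)%N by [].
have := vanishingU
  (block _ F1 P1 (card_before_cvg theta01)
    (fun n i iJ => eps_before n i (k_before n i iJ))
    (fun n i iJ => law_before n i (k_before n i iJ))
    (hoelder_continuous_continuous (proj1 (andP gamma1_bounds)) F1_hoelder))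
  (block _ F2 P2 (card_after_cvg theta01)
    (fun n i iJ => eps_after n i (k_after n i iJ))
    (fun n i iJ => law_after n i (k_after n i iJ))
    (hoelder_continuous_continuous (proj1 (andP gamma2_bounds)) F2_hoelder)).
have mT n : measurable [set w | q < Tstat (e n ^~ w)].
  by apply: measurable_lt_Tstat => //; exact: ltW.
move=> bad; apply: vanishing_setC => //.
apply: vanishing_sub bad => [n|]; first exact: measurableC.
have /andP[t0 t1] := theta01.
(* Tstat_large asks for q < sqrt n * K. *)
pose K : R := theta * (1 - theta) / 2 * (D / 2).
have K0 : 0 < K by rewrite mulr_gt0 ?divr_gt0 ?mulr_gt0 ?subr_gt0.
near=> n => w /=; apply: contra_notP => /not_orP[/negP + /negP +].
rewrite -!leNgt => d1 d2.
apply: Tstat_large d1 d2 => //.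
  by rewrite -ler_pdivrMr//; near: n; exact: nbhs_infty_ger.
rewrite -mulrA -/K -ltr_pdivrMr//.
have n_large : (q / K) ^+ 2 < n%:R by near: n; exact: nbhs_infty_gtr.
rewrite -[ltLHS]gtr0_norm ?divr_gt0// -sqrtr_sqr ltr_sqrt//.
by apply: le_lt_trans n_large; exact: sqr_ge0.
Unshelve. all: by end_near. Qed.
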